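(* Let $m\ge1$, $n\ge0$ be integers with $m+n\ge3$, and let $so(2m-1,\mathbb{C})\oplus so(2n+1,\mathbb{C})\subset so(2m+2n,\mathbb{C})$ be realized as described in the context. The standard $so(2m-1,\mathbb{C})\oplus so(2n+1,\mathbb{C})$-compatible parabolic subalgebras of $so(2m+2n,\mathbb{C})$ are exactly those $\mathfrak{p}_\Pi$, $\Pi\subseteq\Delta=\{\alpha_k-\alpha_{k+1}\mid 1\le k\le m+n-1\}\cup\{\alpha_{m+n-1}+\alpha_{m+n}\}$, such that $\{\alpha_{m+n-1}+\alpha_{m+n},\ \alpha_{m+n-1}-\alpha_{m+n}\}\subseteq\Pi$ or $\{\alpha_{m+n-1}+\alpha_{m+n},\ \alpha_{m+n-1}-\alpha_{m+n}\}\cap\Pi=\emptyset$.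
   Context: $\mathfrak{g}=so(2m+2n,\mathbb{C})$ is the Lie algebra of matrices skew-adjoint relative to the quadratic form $Q=\sum_{i=1}^{m+n}z_iz_{2m+2n+1-i}$ on $\mathbb{C}^{2m+2n}$. Its Cartan subalgebra is $\mathfrak{h}=\{\mathrm{diag}(a_1,\dots,a_{m+n},-a_{m+n},-a_{m+n-1},\dots,-a_1)\}$, $\alpha_k$ maps such a matrix to $a_k$, and the simple system is $\Delta$, with positive system $\Phi^+$. Realization of $so(2m-1,\mathbb{C})\oplus so(2n+1,\mathbb{C})$: with $e_1,\dots,e_{2m+2n}$ the standard basis and $f_\pm=e_{m+n}\pm e_{m+n+1}$, it is the subalgebra of elements of $\mathfrak{g}$ preserving the two $Q$-orthogonal subspaces $V_1=\mathrm{span}\{f_+,\ e_i,\ e_{2m+2n+1-i}\mid 1\le i\le m-1\}$ and $V_2=\mathrm{span}\{f_-,\ e_i,\ e_{2m+2n+1-i}\mid m\le i\le m+n-1\}$; it has the Cartan subalgebra $\{\mathrm{diag}(b_1,\dots,b_{m+n-1},0,0,-b_{m+n-1},\dots,-b_1)\}\subset\mathfrak{h}$. For $\Pi\subseteq\Delta$, the standard parabolic subalgebra is $\mathfrak{p}_\Pi=\mathfrak{h}+\sum_{\alpha\in\Phi^+}\mathfrak{g}_\alpha+\sum_{\alpha\in\mathbb{N}\Pi\cap\Phi^+}\mathfrak{g}_{-\alpha}$, where $\mathfrak{g}_\alpha$ is the root space of $\alpha$ and $\mathbb{N}\Pi$ denotes the non-negative integer combinations of elements of $\Pi$. A semisimple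 element $H\in\mathfrak{g}$ is hyperbolic if all eigenvalues of $\mathrm{ad}(H)$ on $\mathfrak{g}$ are real; for such $H$, $\mathfrak{p}(H)$ is the sum of the eigenspaces of $\mathrm{ad}(H)$ with eigenvalues $\ge 0$, a parabolic subalgebra of $\mathfrak{g}$. For a reductive subalgebra $\mathfrak{g}'$ of $\mathfrak{g}$, a parabolic subalgebra $\mathfrak{p}$ of $\mathfrak{g}$ is $\mathfrak{g}'$-compatible if there exists $H\in\mathfrak{g}'$, hyperbolic as an element of $\mathfrak{g}$, with $\mathfrak{p}=\mathfrak{p}(H)$. *)

(* Defs.v *)
(* The complex numbers are [R[i]] for an arbitrary [R : realType]. *)
From HB Require Import structures.
From mathcomp Require Import all_boot all_order all_algebra.
From mathcomp Require Import complex.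
From mathcomp Require Import boolp classical_sets reals.

Set Implicit Arguments.
Unset Strict Implicit.
Unset Printing Implicit Defensive.

Import Order.TTheory GRing.Theory Num.Theory.

Local Open Scope classical_set_scope.
Local Open Scope ring_scope.

(* All finite sums, with repetitions, of elements of [A].  When [A] is a union
   of subspaces this is the sum of these subspaces; when [A] is a set of roots
   it is the set of non-negative integer combinations of elements of [A]. *)
Definition sums (V : nmodType) (A : set V) : set V :=
  [set x | exists2 s : seq V, (forall y, y \in s -> A y) & x = \sum_(y <- s) y].

Definition bracket (R : realType) (d : nat) (X Y : 'M[R[i]]_d) : 'M[R[i]]_d :=
  X *m Y - Y *m X.

(* Throughout, [N] stands for m + n and matrices have size [N + N]. *)

Definition quadQ (R : realType) (N : nat) (z : 'cV[R[i]]_(N + N)) : R[i] :=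
  \sum_(i < N) z (lshift N i) 0 * z (rev_ord (lshift N i)) 0.

Definition polarQ (R : realType) (N : nat) (v w : 'cV[R[i]]_(N + N)) : R[i] :=
  quadQ (v + w) - quadQ v - quadQ w.

Definition so (R : realType) (N : nat) : set 'M[R[i]]_(N + N) :=
  [set X | forall v w, polarQ (X *m v) w = - polarQ v (X *m w)].
Arguments so : clear implicits.

(* diag(a_1, ..., a_N, -a_N, ..., -a_1) *)
Definition cartan_mx (R : realType) (N : nat) (a : 'rV[R[i]]_N) :
    'M[R[i]]_(N + N) :=
  diag_mx (row_mx a (\row_j - a 0 (rev_ord j))).

Fact cartan_mx_is_linear (R : realType) (N : nat) : linear (@cartan_mx R N).
Proof.
move=> c a b; rewrite /cartan_mx -linearP; congr diag_mx.
rewrite scale_row_mx add_row_mx; congr row_mx.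
by apply/rowP => j; rewrite !mxE opprD mulrN.
Qed.

HB.instance Definition _ (R : realType) (N : nat) :=
  GRing.isLinear.Build R[i] 'rV[R[i]]_N 'M[R[i]]_(N + N) _
    (@cartan_mx R N) (@cartan_mx_is_linear R N).

Definition cartan (R : realType) (N : nat) : {vspace 'M[R[i]]_(N + N)} :=
  limg (linfun (@cartan_mx R N)).

Lemma cartanP (R : realType) (N : nat) (H : 'M[R[i]]_(N + N)) :
  H \in cartan R N <-> exists a : 'rV[R[i]]_N, H = cartan_mx a.
Proof.
split=> [/memv_imgP[a _ ->]|[a ->]]; first by exists a; rewrite lfunE.
by rewrite -(lfunE (@cartan_mx R N)) memv_img ?memvf.
Qed.

Definition cartan_dual (R : realType) (N : nat) :=
  'Hom(subvs_of (cartan R N), R[i]^o).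

(* The standard basis vectors e_1, ..., e_d, numbered from 1. *)
Definition stdvec (R : realType) (d k : nat) : 'cV[R[i]]_d :=
  \col_i (i.+1 == k)%:R.

(* The k-th diagonal entry of a matrix, numbered from 1. *)
Definition diag_entry (R : realType) (N k : nat)
    (H : subvs_of (cartan R N)) : R[i]^o :=
  \sum_(i < N + N | i.+1 == k) vsval H i i.

Fact diag_entry_is_linear (R : realType) (N k : nat) :
  linear (@diag_entry R N k).
Proof.
move=> c H K; rewrite /diag_entry scaler_sumr -big_split /=.
by apply: eq_bigr => i _; rewrite !mxE.
Qed.

HB.instance Definition _ (R : realType) (N k : nat) :=
  GRing.isLinear.Build R[i] (subvs_of (cartan R N)) R[i]^o _
    (@diag_entry R N k) (@diag_entry_is_linear R N k).

(* alpha_k for 1 <= k <= N; other indices are never used. *)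
Definition alpha (R : realType) (N k : nat) : cartan_dual R N :=
  linfun (@diag_entry R N k).

Lemma alphaE (R : realType) (N : nat) (i : 'I_(N + N))
    (H : subvs_of (cartan R N)) :
  alpha R N i.+1 H = vsval H i i.
Proof. by rewrite lfunE /= /diag_entry (big_pred1 i). Qed.

Definition root_space (R : realType) (N : nat) (f : cartan_dual R N) :
    set 'M[R[i]]_(N + N) :=
  [set X | so R N X /\
    forall H : subvs_of (cartan R N), bracket (vsval H) X = f H *: X].

Definition roots (R : realType) (N : nat) : set (cartan_dual R N) :=
  [set f | f != 0 /\ exists2 X, root_space f X & X != 0].
Arguments roots : clear implicits.

Definition simple_roots (R : realType) (N : nat) : set (cartan_dual R N) :=
  [set alpha R N k - alpha R N k.+1 | k in [set k | (1 <= k <= N - 1)%N]]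
  `|` [set alpha R N (N - 1) + alpha R N N].
Arguments simple_roots : clear implicits.

Definition positive_roots (R : realType) (N : nat) : set (cartan_dual R N) :=
  roots R N `&` sums (simple_roots R N).
Arguments positive_roots : clear implicits.

Definition std_parabolic (R : realType) (N : nat) (P : set (cartan_dual R N)) :
    set 'M[R[i]]_(N + N) :=
  sums ([set H | H \in cartan R N]
        `|` \bigcup_(f in positive_roots R N) root_space f
        `|` \bigcup_(f in sums P `&` positive_roots R N) root_space (- f)).

Definition ad_eigenspace (R : realType) (N : nat) (H : 'M[R[i]]_(N + N))
    (c : R[i]) : set 'M[R[i]]_(N + N) :=
  [set X | so R N X /\ bracket H X = c *: X].

Definition ad_eigenvalue (R : realType) (N : nat) (H : 'M[R[i]]_(N + N))
    (c : R[i]) : Prop :=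
  exists2 X, ad_eigenspace H c X & X != 0.

(* ad(H) is diagonalizable on so(2N). *)
Definition semisimple_elt (R : realType) (N : nat) (H : 'M[R[i]]_(N + N)) :
    Prop :=
  so R N H /\ so R N `<=` sums (\bigcup_c ad_eigenspace H c).

Definition hyperbolic (R : realType) (N : nat) (H : 'M[R[i]]_(N + N)) : Prop :=
  semisimple_elt H /\ forall c, ad_eigenvalue H c -> c \is Num.real.

(* In the order of [R[i]], [0 <= c] means that c is real and non-negative. *)
Definition parabolic_of (R : realType) (N : nat) (H : 'M[R[i]]_(N + N)) :
    set 'M[R[i]]_(N + N) :=
  sums (\bigcup_(c in [set c | 0 <= c]) ad_eigenspace H c).

Definition compatible (R : realType) (N : nat) (g' p : set 'M[R[i]]_(N + N)) :
    Prop :=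
  exists H, [/\ g' H, hyperbolic H & p = parabolic_of H].

Definition stdvec_pairs (R : realType) (N : nat) (s : seq nat) :
    seq 'cV[R[i]]_(N + N) :=
  [seq stdvec R (N + N) i | i <- s]
  ++ [seq stdvec R (N + N) (N + N + 1 - i)%N | i <- s].

(* [index_iota a b] enumerates a <= i < b. *)
Definition V1 (R : realType) (m n : nat) :
    {vspace 'cV[R[i]]_((m + n) + (m + n))} :=
  <<(stdvec R _ (m + n) + stdvec R _ (m + n).+1)%R
      :: stdvec_pairs R (m + n) (index_iota 1 m)>>%VS.

Definition V2 (R : realType) (m n : nat) :
    {vspace 'cV[R[i]]_((m + n) + (m + n))} :=
  <<(stdvec R _ (m + n) - stdvec R _ (m + n).+1)%R
      :: stdvec_pairs R (m + n) (index_iota m (m + n))>>%VS.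

(* so(2m-1) (+) so(2n+1), acting on V1 (+) V2. *)
Definition so_odd_odd (R : realType) (m n : nat) :
    set 'M[R[i]]_((m + n) + (m + n)) :=
  [set X | [/\ so R (m + n) X,
    forall v, v \in V1 R m n -> X *m v \in V1 R m n
    & forall v, v \in V2 R m n -> X *m v \in V2 R m n]].
Arguments so_odd_odd : clear implicits.

(* Main.v *)
Require Import Defs.
From HB Require Import structures.
From mathcomp Require Import all_boot all_order all_algebra.
From mathcomp Require Import complex.
From mathcomp Require Import boolp classical_sets reals.
From mathcomp Require Import zify ring.

(** Write N = m + n.  The proof rests on the isometry g that is 1 on V1 and -1
    on V2.  It commutes with every element of so(2m-1) + so(2n+1), and since it
    exchanges e_N and e_(N+1) and multiplies the other basis
    vectors by signs, conjugation by g acts on the weights by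
    alpha_N |-> - alpha_N.  In other words it is the diagram automorphism that
    exchanges the two roots alpha_(N-1) +- alpha_N at the fork of the Dynkin
    diagram.

    If the standard parabolic of Pi equals p(H) with H in the subalgebra, then
    conjugation by g fixes H, preserves each eigenspace of ad H, and hence
    preserves p(H) [parabolic_of_conj, odd_refl_comm].  For a simple root b, the
    standard parabolic contains a vector of weight -b exactly when b is in Pi
    [so_mx_std_parabolic, std_parabolic_opp_simple].  Thus Pi contains both or
    neither of the two roots at the fork [mem_fork_swap].

    Conversely, if Pi contains both or neither, there is a diagonal H with
    alpha_N H = 0 at which a simple root takes the value 0 if it lies in Pi and
    1 otherwise [dominant_exists].  The condition alpha_N H = 0 puts H in the
    subalgebra [cartan_so_odd_odd].  As the roots of so(2N) are the differences
    eps i - eps j of weights of the standard representation, the positive ones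
    being those with i < j [eps_sums], a comparison of weights gives that p(H)
    is the standard parabolic of Pi [parabolic_of_dominant]. *)

Set Implicit Arguments.
Unset Strict Implicit.
Unset Printing Implicit Defensive.

Import Order.TTheory GRing.Theory Num.Theory.

Local Open Scope classical_set_scope.
Local Open Scope ring_scope.

(** * Sums of elements of a set *)

Section Sums.
Variable V : nmodType.
Implicit Types (A : set V) (x y : V).

Lemma sums0 A : sums A 0.
Proof. by exists [::]; rewrite ?big_nil. Qed.

Lemma sumsD A x y : sums A x -> sums A y -> sums A (x + y).
Proof.
move=> [s sA ->] [t tA ->]; exists (s ++ t); rewrite ?big_cat //.
by move=> z; rewrite mem_cat => /orP[/sA|/tA].
Qed.

Lemma sub_sums A : A `<=` sums A.
Proof.
move=> x Ax; exists [:: x]; rewrite ?big_seq1 // => y.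
by rewrite inE => /eqP ->.
Qed.

Lemma sums_ind A (P : V -> Prop) :
  P 0 -> (forall x y, P x -> P y -> P (x + y)) -> (forall x, A x -> P x) ->
  forall x, sums A x -> P x.
Proof.
move=> P0 PD PA _ [s sA ->]; rewrite big_seq.
by apply: big_ind => // y /sA /PA.
Qed.

Lemma sums_sub A (B : set V) : A `<=` sums B -> sums A `<=` sums B.
Proof. by move=> AB; apply: sums_ind => //; [exact: sums0|exact: sumsD]. Qed.

Lemma sums_big A (I : Type) (r : seq I) (P : pred I) (F : I -> V) :
  (forall i, P i -> sums A (F i)) -> sums A (\sum_(i <- r | P i) F i).
Proof. by move=> AF; apply: big_ind; [exact: sums0|exact: sumsD|]. Qed.

End Sums.

(** * The orthogonal algebra and its elementary matrices *)

Section OrthogonalAlgebra.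
Variables (R : realType) (N : nat).
Implicit Types (X Y : 'M[R[i]]_(N + N)) (i j k : 'I_(N + N)).

Lemma rev_lshift (k : 'I_N) : rev_ord (lshift N k) = rshift N (rev_ord k).
Proof. by apply: val_inj => /=; have := ltn_ord k; lia. Qed.

Lemma half_ord_ind (P : 'I_(N + N) -> Prop) :
  (forall k : 'I_N, P (lshift N k)) ->
  (forall k : 'I_N, P (rev_ord (lshift N k))) ->
  forall i, P i.
Proof.
move=> Pl Pr i; case: (splitP i) => k ik.
  by have -> : i = lshift N k by exact: val_inj.
have -> // : i = rev_ord (lshift N (rev_ord k)).
by apply: val_inj => /=; have := ltn_ord k; lia.
Qed.

Lemma polarQE (v w : 'cV[R[i]]_(N + N)) :
  polarQ v w = \sum_k v k 0 * w (rev_ord k) 0.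
Proof.
rewrite /polarQ /quadQ -!sumrB big_split_ord /=.
have revr (i : 'I_N) : rev_ord (rshift N i) = lshift N (rev_ord i).
  by apply: (canLR rev_ordK); rewrite rev_lshift rev_ordK.
rewrite [X in _ = _ + X](reindex_inj rev_ord_inj) -big_split /=.
apply: eq_bigr => i _; rewrite !mxE revr rev_lshift rev_ordK.
ring.
Qed.

(** Skewness means that the matrix changes sign under reflection in its
    antidiagonal: the form pairs each coordinate with the opposite one. *)
Lemma soP X : so R N X <-> forall i j, X i j = - X (rev_ord j) (rev_ord i).
Proof.
split=> [soX i j | skewX v w].
  have := soX (delta_mx j 0) (delta_mx (rev_ord i) 0); rewrite !polarQE.
  rewrite -!colE (bigD1 i) //= big1 => [|k /negPf ki]; last first.
    by rewrite !mxE (inj_eq rev_ord_inj) ki mulr0.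
  rewrite (bigD1 j) //= big1 => [|k /negPf kj]; last by rewrite !mxE kj mul0r.
  by rewrite !mxE !eqxx !mulr1 !mul1r !addr0.
rewrite !polarQE -sumrN.
under eq_bigr do rewrite !mxE mulr_suml.
rewrite exchange_big; apply: eq_bigr => k _ /=.
rewrite mxE mulr_sumr -sumrN (reindex_inj rev_ord_inj) /=.
by apply: eq_bigr => j _; rewrite skewX !rev_ordK; ring.
Qed.

Lemma rev_ord_neq i : rev_ord i != i.
Proof. by apply/eqP => /(congr1 val) /=; have := ltn_ord i; lia. Qed.

(** E_ij - E_j'i', where i' is the index opposite to i.  This is the basic
    root vector of weight eps i - eps j; it is diagonal for j = i and vanishes
    for j = i', which is why 2 eps i is not a root. *)
Definition so_mx i j : 'M[R[i]]_(N + N) :=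
  delta_mx i j - delta_mx (rev_ord j) (rev_ord i).

Lemma so_mxE i j k l :
  so_mx i j k l = ((k == i) && (l == j))%:R
                  - ((k == rev_ord j) && (l == rev_ord i))%:R.
Proof. by rewrite !mxE. Qed.

Lemma so_so_mx i j : so R N (so_mx i j).
Proof.
apply/soP => k l; rewrite !so_mxE opprB !(inj_eq rev_ord_inj).
rewrite !(can2_eq rev_ordK rev_ordK) andbC; congr (_ - _%:R).
by rewrite andbC.
Qed.

Lemma so_mx_self i j : j != rev_ord i -> so_mx i j i j = 1.
Proof. by move=> /negPf ji; rewrite so_mxE !eqxx ji andbF subr0. Qed.

Lemma so_mx_neq0 i j k l : so_mx i j k l != 0 ->
  k = i /\ l = j \/ k = rev_ord j /\ l = rev_ord i.
Proof.
rewrite so_mxE; case: andP => [[/eqP -> /eqP ->]|_]; first by left.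
by case: andP => [[/eqP -> /eqP ->]|_]; [right|rewrite subrr eqxx].
Qed.

Lemma so_antidiag0 X i : so R N X -> X i (rev_ord i) = 0.
Proof.
move=> /soP /(_ i (rev_ord i)); rewrite !rev_ordK => /eqP.
by rewrite -addr_eq0 -mulr2n mulrn_eq0 /= => /eqP.
Qed.

Lemma sum_delta (F : 'I_(N + N) -> 'I_(N + N) -> R[i]) k l :
  \sum_i \sum_j F i j * ((k == i) && (l == j))%:R = F k l.
Proof.
rewrite (bigD1 k) //= [X in _ + X]big1 ?addr0 => [|i /negPf ki]; last first.
  by apply: big1 => j _; rewrite eq_sym ki mulr0.
rewrite (bigD1 l) //= [X in _ + X]big1 ?addr0 => [|j /negPf lj]; last first.
  by rewrite [l == j]eq_sym lj andbF mulr0.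
by rewrite !eqxx mulr1.
Qed.

(** Every X in the orthogonal algebra is the sum of (X i j / 2) so_mx i j over
    all pairs (i, j): each entry is counted once for its own pair and once, by
    skewness, for the opposite pair.  Only pairs with a nonzero entry occur, so
    information on X carried by its nonzero entries passes to the summands. *)
Lemma so_sums (A : set 'M[R[i]]_(N + N)) X : so R N X ->
  (forall i j, X i j != 0 -> sums A ((X i j / 2%:R) *: so_mx i j)) -> sums A X.
Proof.
move=> soX AX.
suff -> : X = \sum_i \sum_(j | X i j != 0) (X i j / 2%:R) *: so_mx i j.
  by apply: sums_big => i _; apply: sums_big => j; exact: AX.
have -> : \sum_i \sum_(j | X i j != 0) (X i j / 2%:R) *: so_mx i j
     = \sum_i \sum_j (X i j / 2%:R) *: so_mx i j.
  apply: eq_bigr => i _; rewrite big_mkcond /=; apply: eq_bigr => j _.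
  by case: eqP => // ->; rewrite mul0r scale0r.
apply/matrixP => k l; rewrite summxE.
under eq_bigr do (rewrite summxE; under eq_bigr do rewrite mxE so_mxE mulrBr).
under eq_bigr do rewrite sumrB; rewrite sumrB.
have rev2 i j : ((k == rev_ord j) && (l == rev_ord i))
    = ((rev_ord l == i) && (rev_ord k == j)).
  by rewrite !(can2_eq rev_ordK rev_ordK) andbC.
rewrite sum_delta; under [X in _ - X]eq_bigr do under eq_bigr do rewrite rev2.
rewrite sum_delta -mulrBl.
move/soP: soX => /(_ (rev_ord l) (rev_ord k)); rewrite !rev_ordK => ->.
by rewrite opprK -[_ + _](mulr2n (X k l)) -[X k l *+ 2]mulr_natr mulfK
  ?pnatr_eq0.
Qed.

End OrthogonalAlgebra.

(** * Weights and roots *)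

Section Cartan.
Variables (R : realType) (N : nat).
Implicit Types (X Y : 'M[R[i]]_(N + N)) (i j k : 'I_(N + N)).
Implicit Types (H : subvs_of (cartan R N)) (f : cartan_dual R N).

Lemma cartan_mx_diag (a : 'rV[R[i]]_N) i j :
  i != j -> cartan_mx a i j = 0.
Proof. by move=> /negPf ij; rewrite mxE ij mulr0n. Qed.

Lemma cartan_mxl (a : 'rV[R[i]]_N) (k : 'I_N) :
  cartan_mx a (lshift N k) (lshift N k) = a 0 k.
Proof. by rewrite mxE eqxx row_mxEl. Qed.

Lemma cartan_mx_rev (a : 'rV[R[i]]_N) i :
  cartan_mx a (rev_ord i) (rev_ord i) = - cartan_mx a i i.
Proof.
have half (k : 'I_N) : cartan_mx a (rev_ord (lshift N k)) (rev_ord (lshift N k))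
    = - cartan_mx a (lshift N k) (lshift N k).
  by rewrite cartan_mxl mxE eqxx rev_lshift row_mxEr mxE rev_ordK.
by elim/half_ord_ind: i => k; [exact: half|rewrite rev_ordK half opprK].
Qed.

Lemma so_cartan_mx (a : 'rV[R[i]]_N) : so R N (cartan_mx a).
Proof.
apply/soP => i j; case: (eqVneq i j) => [->|ij].
  by rewrite cartan_mx_rev opprK.
by rewrite !cartan_mx_diag ?oppr0 // (inj_eq rev_ord_inj) eq_sym.
Qed.

Lemma so_diag_cartan X :
  so R N X -> (forall i j, i != j -> X i j = 0) -> X \in cartan R N.
Proof.
move=> soX X0; apply/cartanP.
exists (\row_k X (lshift N k) (lshift N k)).
apply/matrixP => i j; case: (eqVneq i j) => [<-{j}|ij]; last first.
  by rewrite X0 // cartan_mx_diag.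
have half (k : 'I_N) : X (lshift N k) (lshift N k)
    = cartan_mx (\row_k X (lshift N k) (lshift N k)) (lshift N k) (lshift N k).
  by rewrite cartan_mxl mxE.
elim/half_ord_ind: i => k; first exact: half.
by rewrite cartan_mx_rev -half; move/soP: soX => ->; rewrite !rev_ordK.
Qed.

Lemma bracket_cartan_mx (a : 'rV[R[i]]_N) X i j :
  bracket (cartan_mx a) X i j
  = (cartan_mx a i i - cartan_mx a j j) * X i j.
Proof.
rewrite /bracket mul_diag_mx mul_mx_diag !mxE !eqxx !mulr1n.
by rewrite mulrBl [X i j * _]mulrC.
Qed.

(** The weights of the standard representation, indexed by all N + N
    coordinates: eps (rev_ord i) is the opposite of eps i, so the roots
    +-alpha_k +-alpha_l all take the uniform shape eps i - eps j. *)
Definition eps i : cartan_dual R N := alpha R N i.+1.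

Lemma epsE i H : eps i H = vsval H i i.
Proof. exact: alphaE. Qed.

Lemma eps_rev i : eps (rev_ord i) = - eps i.
Proof.
apply/lfunP => H; rewrite opp_lfunE !epsE.
by have /cartanP[a ->] := subvsP H; exact: cartan_mx_rev.
Qed.

Lemma bracket_cartan H X i j :
  bracket (vsval H) X i j = (eps i - eps j) H * X i j.
Proof.
rewrite add_lfunE opp_lfunE !epsE.
by have /cartanP[a ->] := subvsP H; exact: bracket_cartan_mx.
Qed.

Lemma root_space_weight f X i j :
  root_space f X -> X i j != 0 -> f = eps i - eps j.
Proof.
move=> [_ fX] X0; apply/lfunP => H; apply: (mulIf X0).
by rewrite -bracket_cartan fX mxE.
Qed.

Lemma root_spaceZ f c X : root_space f X -> root_space f (c *: X).
Proof.
move=> [/soP soX fX]; split.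
  by apply/soP => i j; rewrite !mxE soX mulrN.
move=> H; rewrite /bracket -scalemxAl -scalemxAr -scalerBr.
by rewrite -/(bracket _ _) fX scalerA mulrC -scalerA.
Qed.

Lemma root_space_so_mx i j : root_space (eps i - eps j) (so_mx R i j).
Proof.
split=> [|H]; first exact: so_so_mx.
apply/matrixP => k l; rewrite bracket_cartan !mxE -so_mxE.
case: (eqVneq (so_mx R i j k l) 0) => [->|]; first by rewrite !mulr0.
case/so_mx_neq0=> [[-> ->] //|[-> ->]].
by rewrite !eps_rev opprK addrC.
Qed.

Lemma so_mx_cartan i : so_mx R i i \in cartan R N.
Proof.
apply: so_diag_cartan => [|k l kl]; first exact: so_so_mx.
apply: contra_neq_eq kl => /so_mx_neq0.
by move=> [[-> ->]|[-> ->]].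
Qed.

(** Evaluated at the diagonal matrix so_mx i i, the two weights give 1 and 0. *)
Lemma eps_neq i j : i != j -> j != rev_ord i -> eps i - eps j != 0.
Proof.
move=> ij jri; apply/eqP.
move=> /(congr1 (fun f : cartan_dual R N => f (Subvs (so_mx_cartan i)))).
rewrite zero_lfunE add_lfunE opp_lfunE !epsE /= so_mx_self; last first.
  by rewrite eq_sym rev_ord_neq.
suff -> : so_mx R i i j j = 0 by move/eqP; rewrite subr0 oner_eq0.
apply/eqP/negPn/negP => /so_mx_neq0 [[/eqP]|[/eqP]].
  by rewrite eq_sym (negPf ij).
by rewrite (negPf jri).
Qed.

Lemma roots_eps i j :
  i != j -> j != rev_ord i -> Defs.roots R N (eps i - eps j).
Proof.
move=> ij jri; split; first exact: eps_neq.
exists (so_mx R i j); first exact: root_space_so_mx.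
apply/eqP => /matrixP /(_ i j) /eqP.
by rewrite so_mx_self // mxE oner_eq0.
Qed.

Lemma cartan_elt_subproof (a : nat -> R[i]) :
  cartan_mx (\row_(k < N) a k) \in cartan R N.
Proof. by apply/cartanP; eexists. Qed.

Definition cartan_elt a := Subvs (cartan_elt_subproof a).

Lemma alpha_cartan_elt a (k : nat) :
  (k < N)%N -> alpha R N k.+1 (cartan_elt a) = a k.
Proof.
move=> kN.
have -> : alpha R N k.+1 = eps (lshift N (Ordinal kN)) by [].
by rewrite epsE cartan_mxl mxE.
Qed.

Lemma simple_roots_ind (P : cartan_dual R N -> Prop) :
  (forall k : nat, (k.+1 < N)%N -> P (alpha R N k.+1 - alpha R N k.+2)) ->
  P (alpha R N (N - 1) + alpha R N N) ->
  forall f, simple_roots R N f -> P f.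
Proof.
move=> Pm Pp f [[[//|k] /= kN <-]|->//].
by apply: Pm; lia.
Qed.

Lemma alpha_sub_sums (i j : nat) : (0 < i <= j)%N -> (j <= N)%N ->
  sums (simple_roots R N) (alpha R N i - alpha R N j).
Proof.
move=> /andP[i0]; elim: j => [|j IHj] ij jN; first by lia.
case: (eqVneq i j.+1) => [->|ij']; first by rewrite subrr; exact: sums0.
rewrite -[alpha R N i](subrK (alpha R N j)) -addrA.
apply: sumsD; first by apply: IHj; lia.
by apply: sub_sums; left; exists j => //=; lia.
Qed.

(** alpha_i + alpha_j is the last simple root plus a chain from i up to N - 1
    and a chain from j up to N. *)
Lemma alpha_add_sums (i j : nat) : (0 < i < j)%N -> (j <= N)%N ->
  sums (simple_roots R N) (alpha R N i + alpha R N j).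
Proof.
move=> ij jN.
have -> : alpha R N i + alpha R N j
    = (alpha R N i - alpha R N (N - 1)) + (alpha R N j - alpha R N N)
      + (alpha R N (N - 1) + alpha R N N).
  by rewrite [_ - _ + _]addrACA -opprD subrK.
apply: sumsD; last by apply: sub_sums; right.
by apply: sumsD; apply: alpha_sub_sums; lia.
Qed.

(** Positive roots are those of upper triangular entries: the two indices lie
    either in the same half, giving a difference of two alphas, or in opposite
    halves, giving a sum. *)
Lemma eps_sums i j : (i < j)%N -> j != rev_ord i ->
  sums (simple_roots R N) (eps i - eps j).
Proof.
move=> ij jri.
have neg k : eps k = - alpha R N (N + N - k.+1).+1.
  by rewrite -[LHS]opprK -eps_rev.
case: (ltnP j N) => jN; first by apply: alpha_sub_sums; lia.
case: (ltnP i N) => iN; last first.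
  rewrite !neg opprK addrC.
  by have := ltn_ord j => jN2; apply: alpha_sub_sums; lia.
rewrite [eps j]neg opprK.
have jri' : (N + N - j.+1 != i)%N.
  by apply: contra_neq jri => ji; apply: val_inj => /=; have := ltn_ord j; lia.
have := ltn_ord j.
case: (ltngtP i (N + N - j.+1)) => [ij'|ij'|ij'] jN2.
- by apply: alpha_add_sums; lia.
- by rewrite addrC; apply: alpha_add_sums; lia.
by move: jri'; rewrite ij' eqxx.
Qed.

Lemma positive_roots_eps i j : (i < j)%N -> j != rev_ord i ->
  positive_roots R N (eps i - eps j).
Proof.
move=> ij jri; split; last exact: eps_sums.
by apply: roots_eps => //; apply: contraTneq ij => ->; rewrite ltnn.
Qed.

(** ** Matrix entries of standard parabolic subalgebras *)

Lemma std_parabolic_entry Pi X i j :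
  std_parabolic Pi X -> X i j != 0 ->
  sums (simple_roots R N) (eps i - eps j) \/ sums Pi (eps j - eps i).
Proof.
move=> pX; apply: contra_neqP => nij; move: X pX.
apply: (sums_ind (P := fun X => X i j = 0)) => [|X Y X0 Y0|X pX].
- by rewrite mxE.
- by rewrite mxE X0 Y0 addr0.
apply/eqP/negPn/negP => Xij; apply: nij.
case: pX => [[cX|[f [_ fS] fX]]|[f [fS _] fX]].
- move: Xij; have /cartanP[a ->] := cX.
  case: (eqVneq i j) => [->|ij]; last by rewrite cartan_mx_diag ?eqxx.
  by left; rewrite subrr; exact: sums0.
- by left; rewrite -(root_space_weight fX Xij).
by right; rewrite -opprB -(root_space_weight fX Xij) opprK.
Qed.

(** For a simple root b, membership of b in Pi can be read off from the entry
    at which a root vector of -b lives.  The fundamental coweight H of b does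
    this: it excludes -b from the positive weights, and it separates b from all
    sums of the other simple roots. *)
Lemma std_parabolic_opp_simple Pi X H i j :
  Pi `<=` simple_roots R N ->
  (forall f, simple_roots R N f -> f != eps j - eps i -> f H = 0) ->
  0 < (eps j - eps i) H ->
  std_parabolic Pi X -> X i j != 0 -> Pi (eps j - eps i).
Proof.
move=> PiS H0 Hpos pX Xij; set b := eps j - eps i in H0 Hpos *.
case: (std_parabolic_entry pX Xij) => [bS|bPi].
  have : 0 <= (eps i - eps j) H.
    move: bS; apply: (sums_ind (P := fun f : cartan_dual R N => 0 <= f H)).
    - by rewrite zero_lfunE.
    - by move=> f g fH gH; rewrite add_lfunE addr_ge0.
    move=> f fS; case: (eqVneq f b) => [->|fb]; first exact: ltW.
    by rewrite H0.
  by rewrite -opprB opp_lfunE oppr_ge0 lt_geF.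
case: (pselect (Pi b)) => // nPi.
have : b H = 0.
  move: bPi; apply: (sums_ind (P := fun f : cartan_dual R N => f H = 0)).
  - by rewrite zero_lfunE.
  - by move=> f g fH gH; rewrite add_lfunE fH gH addr0.
  move=> f fPi; apply: H0; first exact: PiS.
  by apply/eqP => fb; apply: nPi; rewrite -fb.
by move=> bH; move: Hpos; rewrite bH ltxx.
Qed.

Lemma so_mx_std_parabolic Pi i j :
  (i < j)%N -> j != rev_ord i -> Pi (eps i - eps j) ->
  std_parabolic Pi (so_mx R j i).
Proof.
move=> ij jri Pij; apply: sub_sums; right; exists (eps i - eps j).
  by split; [exact: sub_sums|exact: positive_roots_eps].
by rewrite opprB; exact: root_space_so_mx.
Qed.

End Cartan.

(** * Standard parabolic subalgebras defined by dominant elements *)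

Section Dominant.
Variables (R : realType) (N : nat) (Pi : set (cartan_dual R N)).
Variable H : subvs_of (cartan R N).
Hypothesis PiS : Pi `<=` simple_roots R N.
Hypothesis H_dom : forall f,
  simple_roots R N f -> 0 <= f H /\ (f H = 0 <-> Pi f).
Implicit Types (X Y : 'M[R[i]]_(N + N)) (i j k : 'I_(N + N)).
Implicit Types (f : cartan_dual R N).

(** A sum of non-negative numbers vanishes only if each of them does, so a
    positive root vanishing at H involves only simple roots of Pi. *)
Lemma dominant_sums f :
  sums (simple_roots R N) f -> 0 <= f H /\ (f H = 0 -> sums Pi f).
Proof.
move: f; apply: sums_ind => [|f g [f0 fPi] [g0 gPi]|f fS].
- by rewrite zero_lfunE; split=> // _; exact: sums0.
- rewrite add_lfunE addr_ge0 //; split=> // /eqP.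
  by rewrite paddr_eq0 // => /andP[/eqP/fPi fs /eqP/gPi gs]; exact: sumsD.
have [fH fPi] := H_dom fS; split=> // /fPi; exact: sub_sums.
Qed.

Lemma dominant_sums0 f : sums Pi f -> f H = 0.
Proof.
move: f; apply: sums_ind => [|f g fH gH|f fPi]; first by rewrite zero_lfunE.
  by rewrite add_lfunE fH gH addr0.
by apply: (H_dom (PiS fPi)).2.2.
Qed.

Lemma ad_eigenspace_entry c X i j : ad_eigenspace (vsval H) c X ->
  X i j != 0 -> (eps R i - eps R j) H = c.
Proof.
move=> [_ cX] Xij; apply: (mulIf Xij).
by rewrite -bracket_cartan cX mxE.
Qed.

(** Both sides are spanned by weight vectors, so it suffices to compare
    weights: on an entry below the diagonal, where the weight is negative or
    zero at H, non-negativity forces it to vanish and dominant_sums applies. *)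
Lemma parabolic_of_dominant : std_parabolic Pi = parabolic_of (vsval H).
Proof.
apply/seteqP; split; apply: sums_sub => X.
  case=> [[cX|[f [_ fS] fX]]|[f [fPi _] [soX fX]]]; apply: sub_sums.
  - exists 0; first exact: lexx.
    have /cartanP[a ->] := cX; split; first exact: so_cartan_mx.
    apply/matrixP => i j; rewrite bracket_cartan !mxE mul0r.
    case: (eqVneq i j) => [->|ij]; first by rewrite subrr zero_lfunE mul0r.
    by rewrite mulr0n mulr0.
  - by exists (f H); [exact: (dominant_sums fS).1|case: fX].
  exists 0; first exact: lexx.
  by split=> //; rewrite fX opp_lfunE dominant_sums0 ?oppr0.
move=> [c c0 cX]; have soX := cX.1; apply: so_sums => // i j Xij.
have Hij := ad_eigenspace_entry cX Xij; apply: sub_sums.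
have jri : j != rev_ord i.
  by apply: contra_neq Xij => ->; exact: so_antidiag0.
case: (ltngtP i j) => [ij|ji|ij].
- left; right; exists (eps R i - eps R j); first exact: positive_roots_eps.
  exact/root_spaceZ/root_space_so_mx.
- right; exists (eps R j - eps R i); last first.
    by rewrite opprB; exact/root_spaceZ/root_space_so_mx.
  have irj : i != rev_ord j by rewrite eq_sym (can2_eq rev_ordK rev_ordK).
  have pji := positive_roots_eps R ji irj; split=> //.
  have [ge0 eq0] := dominant_sums pji.2; apply: eq0.
  apply/eqP; rewrite eq_le ge0 andbT.
  by rewrite -opprB opp_lfunE Hij oppr_le0.
left; left; have -> : j = i by exact/val_inj.
exact/memvZ/so_mx_cartan.
Qed.

(** The matrices so_mx i j diagonalize ad H, and its eigenvalues are 0 and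
    values of positive roots up to sign. *)
Lemma hyperbolic_dominant : hyperbolic (vsval H).
Proof.
split; first split.
- by have /cartanP[a ->] := subvsP H; exact: so_cartan_mx.
- move=> X soX; apply: so_sums => // i j _; apply: sub_sums.
  exists ((eps R i - eps R j) H) => //.
  by have [soij Hij] := root_spaceZ (X i j / 2%:R) (root_space_so_mx R i j).
(* an eigenvalue is the weight of any nonzero entry of its eigenvectors *)
move=> c [X cX /matrix0Pn[i [j Xij]]].
have jri : j != rev_ord i.
  by apply: contra_neq Xij => ->; exact: so_antidiag0 cX.1.
rewrite -(ad_eigenspace_entry cX Xij).
case: (ltngtP i j) => [ij|ji|ij].
- by apply: ger0_real; exact: (dominant_sums (eps_sums R ij jri)).1.
- have irj : i != rev_ord j by rewrite eq_sym (can2_eq rev_ordK rev_ordK).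
  rewrite -opprB opp_lfunE realN; apply: ger0_real.
  exact: (dominant_sums (eps_sums R ji irj)).1.
by have -> : j = i by [exact/val_inj]; rewrite subrr zero_lfunE real0.
Qed.

End Dominant.

Section Existence.
Variables (R : realType) (N : nat) (Pi : set (cartan_dual R N)).

(** The coordinate alpha_k of H counts the roots alpha_l - alpha_(l+1), l >= k,
    outside Pi; hence each of these roots takes the value 0 or 1 at H according
    to whether it lies in Pi.  As alpha_N vanishes at H, the two roots
    alpha_(N-1) +- alpha_N take the same value, and the hypothesis that Pi does
    not separate them makes this value right for both. *)
Lemma dominant_exists : (1 < N)%N ->
  (Pi (alpha R N (N - 1) + alpha R N N)
   <-> Pi (alpha R N (N - 1) - alpha R N N)) ->
  exists H : subvs_of (cartan R N),
    (forall f, simple_roots R N f -> 0 <= f H /\ (f H = 0 <-> Pi f))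
    /\ alpha R N N H = 0.
Proof.
move=> N1 Piam.
pose outside l : nat := ~~ `[< Pi (alpha R N l - alpha R N l.+1) >].
pose H := cartan_elt N (fun k => (\sum_(k.+1 <= l < N) outside l)%:R : R[i]).
have HN : alpha R N N H = 0.
  case: (N) N1 @H => // M _ H; by rewrite alpha_cartan_elt // big_geq.
have Hm (k : nat) : (k.+1 < N)%N ->
    (alpha R N k.+1 - alpha R N k.+2) H = (outside k.+1)%:R.
  move=> kN; rewrite add_lfunE opp_lfunE !alpha_cartan_elt //; last exact: ltnW.
  by rewrite big_ltn // natrD addrK.
have outsideP l (f : cartan_dual R N) :
    (Pi f <-> Pi (alpha R N l - alpha R N l.+1)) ->
    (0 : R[i]) <= (outside l)%:R /\ ((outside l)%:R = 0 :> R[i] <-> Pi f).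
  move=> fl; rewrite ler0n; split=> //; rewrite /outside fl.
  by case: asboolP => Pil; split=> // /eqP; rewrite oner_eq0.
exists H; split=> //; apply: simple_roots_ind => [k kN|].
  by rewrite Hm //; exact: outsideP.
have := Hm (N - 2)%N; have -> : ((N - 2).+1 = N - 1)%N by lia.
have eN : ((N - 1).+1 = N)%N by lia.
have := @outsideP (N - 1)%N _; rewrite eN => oP.
rewrite !add_lfunE opp_lfunE HN subr0 addr0 => -> //.
exact: oP.
Qed.

End Existence.

(** * Signed reflections of the coordinate space *)

Section Reflection.
Variables (R : realType) (N : nat).
Implicit Types (X Y : 'M[R[i]]_(N + N)) (i j k : 'I_(N + N)).

(** The indices k and rev_ord k belong to opposite weights; fold k is the common
    0-based rank of this pair among the alphas. *)
Definition fold k : nat := minn k (rev_ord k).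

Lemma fold_rev k : fold (rev_ord k) = fold k.
Proof. by rewrite /fold rev_ordK minnC. Qed.

(** Exchanges the two middle coordinates, changing the sign of alpha_N. *)
Definition swap k := if fold k == N.-1 then rev_ord k else k.

Lemma fold_swap k : fold (swap k) = fold k.
Proof. by rewrite /swap; case: ifP => // _; exact: fold_rev. Qed.

Lemma swapK : involutive swap.
Proof.
move=> k; rewrite {1}/swap fold_swap /swap.
by case: eqP => // _; exact: rev_ordK.
Qed.

Lemma swap_rev k : swap (rev_ord k) = rev_ord (swap k).
Proof. by rewrite /swap fold_rev; case: ifP. Qed.

(** The exchange of the two middle coordinates, followed by sign changes that
    are the same on opposite coordinates.  It is an isometry of determinant -1
    of the quadratic form, so it need not preserve the standard parabolic
    subalgebras. *)
Definition refl_mx (b : pred nat) : 'M[R[i]]_(N + N) :=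
  \matrix_(i, j) ((-1) ^+ b (fold i) * (swap i == j)%:R).

Lemma mul_refl_mx b X i j :
  (refl_mx b *m X) i j = (-1) ^+ b (fold i) * X (swap i) j.
Proof.
rewrite mxE (bigD1 (swap i)) //= big1 ?addr0 => [|k /negPf ki].
  by rewrite mxE eqxx mulr1.
by rewrite mxE eq_sym ki mulr0 mul0r.
Qed.

Lemma mul_mx_refl b X i j :
  (X *m refl_mx b) i j = X i (swap j) * (-1) ^+ b (fold j).
Proof.
rewrite mxE (bigD1 (swap j)) //= big1 ?addr0 => [|k /negPf kj].
  by rewrite mxE fold_swap swapK eqxx mulr1.
by rewrite mxE (can2_eq swapK swapK) kj !mulr0.
Qed.

Lemma refl_mx_delta b k :
  refl_mx b *m delta_mx k 0
  = (-1) ^+ b (fold k) *: delta_mx (swap k) 0 :> 'cV_(N + N).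
Proof.
apply/colP => i; rewrite -colE !mxE andbT (can2_eq swapK swapK).
by case: eqP => [->|]; rewrite ?mulr0 // fold_swap.
Qed.

Lemma conj_refl_mx b X i j : (refl_mx b *m X *m refl_mx b) i j
  = (-1) ^+ b (fold i) * (-1) ^+ b (fold j) * X (swap i) (swap j).
Proof. by rewrite mul_mx_refl mul_refl_mx; ring. Qed.

Lemma so_conj_refl_mx b X : so R N X -> so R N (refl_mx b *m X *m refl_mx b).
Proof.
move=> /soP soX; apply/soP => i j.
by rewrite !conj_refl_mx soX !fold_rev !swap_rev; ring.
Qed.

(** The matrix g = refl_mx b is an involution, so X |-> g X g is a conjugation;
    if it fixes H, it preserves each eigenspace of ad H. *)
Lemma parabolic_of_conj b H X : refl_mx b *m H = H *m refl_mx b ->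
  parabolic_of H X -> parabolic_of H (refl_mx b *m X *m refl_mx b).
Proof.
move=> gH; move: X; set g := refl_mx b in gH *.
apply: sums_ind => [|X Y gX gY|X [c c0 [soX HX]]].
- by rewrite mulmx0 mul0mx; exact: sums0.
- by rewrite mulmxDr mulmxDl; exact: sumsD.
apply: sub_sums; exists c => //; split; first exact: so_conj_refl_mx.
rewrite scalemxAl scalemxAr -HX /bracket mulmxBr mulmxBl.
by rewrite !mulmxA -gH -!mulmxA -gH.
Qed.

(** The vectors stdvec are numbered from 1, ordinals from 0. *)
Lemma stdvecE (d l : nat) (k : 'I_d) : l = k.+1 -> stdvec R d l = delta_mx k 0.
Proof. by move=> ->; apply/colP => i; rewrite !mxE eqSS andbT. Qed.

Lemma stdvec_pairsP (a b : nat) (v : 'cV[R[i]]_(N + N)) :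
  (0 < a)%N -> (b <= N.+1)%N ->
  v \in stdvec_pairs R N (index_iota a b) <->
  exists2 k, (a <= (fold k).+1 < b)%N & v = delta_mx k 0.
Proof.
move=> a0 bN; rewrite /fold; split.
  rewrite mem_cat => /orP[] /mapP[l]; rewrite mem_index_iota => lab ->.
    have lN : (l.-1 < N + N)%N by lia.
    by exists (Ordinal lN); [rewrite /=; lia|apply: stdvecE => /=; lia].
  have lN : (N + N - l < N + N)%N by lia.
  by exists (Ordinal lN); [rewrite /=; lia|apply: stdvecE => /=; lia].
move=> [k kab ->]; rewrite mem_cat; apply/orP.
move: kab => /=; have := ltn_ord k => kN kab.
case: (ltnP k N) => kN1; [left|right]; apply/mapP.
  exists k.+1; first by rewrite mem_index_iota; lia.
  by rewrite (stdvecE (k := k)).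
exists (rev_ord k).+1; first by rewrite mem_index_iota /=; lia.
by rewrite (stdvecE (k := k)) //=; lia.
Qed.

Lemma span_mulmx d (s : seq 'cV[R[i]]_d) (U : {vspace 'cV[R[i]]_d}) (M : 'M_d) :
  (forall v, v \in s -> M *m v \in U) ->
  forall v, v \in <<s>>%VS -> M *m v \in U.
Proof.
move=> sU v; have : (<<s>> <= linfun (mulmx M) @^-1: U)%VS.
  by apply/span_subvP => w ws; rewrite -memv_preim lfunE /=; exact: sU.
by move=> /subvP /(_ v) sub /sub; rewrite -memv_preim lfunE.
Qed.

End Reflection.

(** * The subspaces V1 and V2 *)

Section OddOdd.
Variables (R : realType) (m n : nat).
Hypotheses (hm : (1 <= m)%N) (hN : (1 < m + n)%N).
Local Notation N := (m + n)%N.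
Implicit Types (k : 'I_(N + N)).

Lemma mid_subproof : (N.-1 < N + N)%N. Proof. lia. Qed.
Definition mid : 'I_(N + N) := Ordinal mid_subproof.

Lemma stdvec_mid : stdvec R (N + N) N = delta_mx mid 0.
Proof. by apply: stdvecE => /=; lia. Qed.

Lemma stdvec_midS : stdvec R (N + N) N.+1 = delta_mx (rev_ord mid) 0.
Proof. by apply: stdvecE => /=; lia. Qed.

Lemma fold_mid : fold mid = N.-1.
Proof. by rewrite /fold /=; lia. Qed.

Lemma fold_eq_mid k : fold k = N.-1 -> k = mid \/ k = rev_ord mid.
Proof.
rewrite /fold /= => kN; have := ltn_ord k => kN2.
case: (ltnP k N) => kN1; [left|right]; apply: val_inj => /=; lia.
Qed.

Lemma V1_gen v :
  v \in (stdvec R _ N + stdvec R _ N.+1) :: stdvec_pairs R N (index_iota 1 m) ->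
  v = delta_mx mid 0 + delta_mx (rev_ord mid) 0
  \/ exists2 k, (fold k < m.-1)%N & v = delta_mx k 0.
Proof.
rewrite inE stdvec_mid stdvec_midS => /orP[/eqP ->|]; first by left.
move/stdvec_pairsP => -[//||k km ->]; first by lia.
by right; exists k => //; lia.
Qed.

Lemma V2_gen v :
  v \in (stdvec R _ N - stdvec R _ N.+1) :: stdvec_pairs R N (index_iota m N) ->
  v = delta_mx mid 0 - delta_mx (rev_ord mid) 0
  \/ exists2 k, (m.-1 <= fold k < N.-1)%N & v = delta_mx k 0.
Proof.
rewrite inE stdvec_mid stdvec_midS => /orP[/eqP ->|]; first by left.
move/stdvec_pairsP => -[//||k km ->]; first by lia.
by right; exists k => //; lia.
Qed.

Lemma V1_mid : delta_mx mid 0 + delta_mx (rev_ord mid) 0 \in V1 R m n.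
Proof.
by rewrite -stdvec_mid -stdvec_midS; apply: memv_span; rewrite inE eqxx.
Qed.

Lemma V2_mid : delta_mx mid 0 - delta_mx (rev_ord mid) 0 \in V2 R m n.
Proof.
by rewrite -stdvec_mid -stdvec_midS; apply: memv_span; rewrite inE eqxx.
Qed.

Lemma V1_delta k : (fold k < m.-1)%N -> delta_mx k 0 \in V1 R m n.
Proof.
move=> km; apply: memv_span; rewrite inE; apply/orP; right.
by apply/stdvec_pairsP => //; [lia|exists k => //; lia].
Qed.

Lemma V2_delta k : (m.-1 <= fold k < N.-1)%N -> delta_mx k 0 \in V2 R m n.
Proof.
move=> km; apply: memv_span; rewrite inE; apply/orP; right.
by apply/stdvec_pairsP => //; exists k => //; lia.
Qed.

(** V1 and V2 together contain all basis vectors but the two middle ones, whose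
    sum lies in V1 and whose difference lies in V2; so they span everything. *)
Lemma mx_eq0_V1_V2 (M : 'M[R[i]]_(N + N)) :
  (forall v, v \in V1 R m n -> M *m v = 0) ->
  (forall v, v \in V2 R m n -> M *m v = 0) -> M = 0.
Proof.
move=> M1 M2; have Mp := M1 _ V1_mid; have Mm := M2 _ V2_mid.
have Mmid : M *m delta_mx mid 0 = 0 :> 'cV_(N + N).
  have : M *m delta_mx mid 0 *+ 2 = 0 :> 'cV_(N + N).
    have := congr2 +%R Mp Mm; rewrite addr0 -mulmxDr addrACA subrr addr0.
    by rewrite mulmxDr -mulr2n.
  by move/eqP; rewrite -scaler_nat scaler_eq0 pnatr_eq0 /= => /eqP.
have Mrev : M *m delta_mx (rev_ord mid) 0 = 0 :> 'cV_(N + N).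
  by move: Mp; rewrite mulmxDr Mmid add0r.
suff Mk k : M *m delta_mx k 0 = 0 :> 'cV_(N + N).
  by apply/matrixP => i k; have /colP/(_ i) := Mk k; rewrite -colE !mxE.
case: (ltnP (fold k) m.-1) => km; first exact/M1/V1_delta.
case: (ltnP (fold k) N.-1) => kN; first by apply/M2/V2_delta; rewrite km.
have /fold_eq_mid [->//|->//] : fold k = N.-1.
by move: kN; rewrite /fold /=; have := ltn_ord k; lia.
Qed.

Definition odd_sign : pred nat := fun l => (m.-1 <= l < N.-1)%N.
(** The signs are chosen to make this the identity on V1 and -1 on V2; the
    dimension 2n + 1 of V2 is odd, hence the determinant -1. *)
Definition odd_refl : 'M[R[i]]_(N + N) := refl_mx R N odd_sign.

Lemma odd_refl_mid :
  odd_refl *m delta_mx mid 0 = delta_mx (rev_ord mid) 0 :> 'cV_(N + N).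
Proof.
by rewrite refl_mx_delta /swap fold_mid eqxx /odd_sign ltnn andbF scale1r.
Qed.

Lemma odd_refl_rev_mid :
  odd_refl *m delta_mx (rev_ord mid) 0 = delta_mx mid 0 :> 'cV_(N + N).
Proof.
rewrite refl_mx_delta /swap fold_rev fold_mid eqxx rev_ordK.
by rewrite /odd_sign ltnn andbF scale1r.
Qed.

Lemma odd_refl_V1 v : v \in V1 R m n -> odd_refl *m v = v.
Proof.
move=> vV; apply/eqP; rewrite -subr_eq0 -{2}[v]mul1mx -mulmxBl -memv0.
move: v vV; apply: span_mulmx => v /V1_gen vE.
rewrite memv0 mulmxBl mul1mx subr_eq0; case: vE => [->|[k km ->]].
  by rewrite mulmxDr odd_refl_mid odd_refl_rev_mid addrC.
rewrite refl_mx_delta /swap /odd_sign.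
have -> : (fold k == N.-1) = false by lia.
have -> : (m.-1 <= fold k < N.-1)%N = false by lia.
by rewrite scale1r.
Qed.

Lemma odd_refl_V2 v : v \in V2 R m n -> odd_refl *m v = - v.
Proof.
move=> vV; apply/eqP; rewrite -addr_eq0 -{2}[v]mul1mx -mulmxDl -memv0.
move: v vV; apply: span_mulmx => v /V2_gen vE.
rewrite memv0 mulmxDl mul1mx addr_eq0; case: vE => [->|[k km ->]].
  by rewrite mulmxBr odd_refl_mid odd_refl_rev_mid opprB.
rewrite refl_mx_delta /swap /odd_sign km scaleN1r.
by have -> : (fold k == N.-1) = false by lia.
Qed.

Lemma odd_refl_comm H : so_odd_odd R m n H -> odd_refl *m H = H *m odd_refl.
Proof.
move=> [_ H1 H2]; apply/eqP; rewrite -subr_eq0; apply/eqP.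
apply: mx_eq0_V1_V2 => v vV; rewrite mulmxBl -!mulmxA.
  by rewrite !odd_refl_V1 ?subrr // H1.
by rewrite !odd_refl_V2 ?H2 // mulmxN subrr.
Qed.

(** H acts by scalars on the basis vectors, and kills the middle two. *)
Lemma cartan_so_odd_odd (H : subvs_of (cartan R N)) :
  alpha R N N H = 0 -> so_odd_odd R m n (vsval H).
Proof.
move=> HN.
have Hdelta k :
    vsval H *m delta_mx k 0 = eps R k H *: delta_mx k 0 :> 'cV_(N + N).
  rewrite epsE; have /cartanP[a ->] := subvsP H.
  apply/colP => i; rewrite -colE !mxE.
  case: eqP => [->|]; first by rewrite eqxx mulr1.
  by rewrite !mulr0n mulr0.
have epsN : eps R mid H = 0.
  by rewrite -[RHS]HN /eps; congr (alpha R N _ H); rewrite /=; lia.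
have Hmid : vsval H *m delta_mx mid 0 = 0 :> 'cV_(N + N).
  by rewrite Hdelta epsN scale0r.
have Hrev : vsval H *m delta_mx (rev_ord mid) 0 = 0 :> 'cV_(N + N).
  by rewrite Hdelta eps_rev opp_lfunE epsN oppr0 scale0r.
split.
- by have /cartanP[a ->] := subvsP H; exact: so_cartan_mx.
- apply: span_mulmx => v /V1_gen [->|[k km ->]].
    by rewrite mulmxDr Hmid Hrev addr0 mem0v.
  by rewrite Hdelta; apply/memvZ/V1_delta.
apply: span_mulmx => v /V2_gen [->|[k km ->]].
  by rewrite mulmxBr Hmid Hrev subr0 mem0v.
by rewrite Hdelta; apply/memvZ/V2_delta.
Qed.

End OddOdd.

(** * Parabolic subalgebras stable under a reflection *)

Section Swap.
Variables (R : realType) (N : nat) (Pi : set (cartan_dual R N)) (b : pred nat).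
Hypotheses (N1 : (1 < N)%N) (PiS : Pi `<=` simple_roots R N).
Hypothesis stable : forall X, std_parabolic Pi X ->
  std_parabolic Pi (refl_mx R N b *m X *m refl_mx R N b).

(** The reflection carries a root vector of -(eps q - eps p') into a root vector
    of -(eps q - eps p), where p and p' are the middle indices. *)
Lemma mem_swap_simple (q p : 'I_(N + N)) (H : subvs_of (cartan R N)) :
  q.+2 = N -> fold p = N.-1 ->
  (forall f, simple_roots R N f -> f != eps R q - eps R p -> f H = 0) ->
  0 < (eps R q - eps R p) H ->
  Pi (eps R q - eps R (rev_ord p)) -> Pi (eps R q - eps R p).
Proof.
move=> qN pN H0 Hpos Piq; have pN' := pN; rewrite /fold /= in pN'.
have ltp := ltn_ord p.
have fq : fold q != N.-1 by rewrite /fold /=; lia.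
have qr : (q < rev_ord p)%N by rewrite /=; lia.
have rq : rev_ord p != rev_ord q.
  by rewrite (inj_eq rev_ord_inj); apply: contra_neq fq => <-.
have qp : q != rev_ord (rev_ord p).
  by rewrite rev_ordK eq_sym -(inj_eq rev_ord_inj).
have pX := stable (so_mx_std_parabolic qr rq Piq).
apply: (std_parabolic_opp_simple PiS H0 Hpos pX).
rewrite conj_refl_mx /swap pN eqxx (negPf fq) so_mx_self //.
by rewrite mulr1 -signr_addb signr_eq0.
Qed.

(** The coweights separating alpha_(N-1) +- alpha_N from the other simple roots
    are, up to scaling, (1, ..., 1, +-1) in the coordinates alpha_1, ..., alpha_N. *)
Lemma mem_fork_swap :
  Pi (alpha R N (N - 1) + alpha R N N) <-> Pi (alpha R N (N - 1) - alpha R N N).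
Proof.
have qN : (N - 2 < N + N)%N by lia.
have pN : (N - 1 < N + N)%N by lia.
set q := Ordinal qN; set p := Ordinal pN.
have -> : alpha R N (N - 1) = eps R q by rewrite /eps; congr alpha => /=; lia.
have alphaN : alpha R N N = eps R p by rewrite /eps; congr alpha => /=; lia.
have -> : eps R q + alpha R N N = eps R q - eps R (rev_ord p).
  by rewrite eps_rev opprK alphaN.
have -> : eps R q - alpha R N N = eps R q - eps R p by rewrite alphaN.
have fp : fold p = N.-1 by rewrite /fold /=; lia.
pose H (c : R[i]) := cartan_elt N (fun k => if k == N.-1 then c else 1).
have Hq c : eps R q (H c) = 1.
  by rewrite /eps alpha_cartan_elt /=; [case: eqP => //; lia|lia].
have Hp c : eps R p (H c) = c.
  by rewrite /eps alpha_cartan_elt /=; [case: eqP => //; lia|lia].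
have simpleE f : simple_roots R N f -> f = eps R q - eps R (rev_ord p)
    \/ f = eps R q - eps R p \/ forall c, f (H c) = 0.
  move: f; apply: simple_roots_ind => [k kN|].
    right; case: (eqVneq k.+2 N) => [kN2|kN2].
      left; rewrite /eps; congr (alpha R N _ - alpha R N _) => /=; lia.
    right => c; rewrite add_lfunE opp_lfunE !alpha_cartan_elt; try lia.
    have -> : (k == N.-1) = false by lia.
    have -> : (k.+1 == N.-1) = false by lia.
    by rewrite subrr.
  left; rewrite eps_rev opprK /eps.
  by congr (alpha R N _ + alpha R N _) => /=; lia.
split.
  apply: (@mem_swap_simple q p (H (-1))) => //.
  - by rewrite /=; lia.
  - move=> f /simpleE [->|[->|->//]]; last by rewrite eqxx.
    by rewrite eps_rev opprK add_lfunE Hq Hp subrr.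
  by rewrite add_lfunE opp_lfunE Hq Hp opprK addr_gt0.
have -> : eps R q - eps R p = eps R q - eps R (rev_ord (rev_ord p)).
  by rewrite rev_ordK.
apply: (@mem_swap_simple q (rev_ord p) (H 1)) => //.
- by rewrite /=; lia.
- by rewrite fold_rev.
- move=> f /simpleE [->|[->|->//]]; first by rewrite eqxx.
  by rewrite add_lfunE opp_lfunE Hq Hp subrr.
by rewrite eps_rev opprK add_lfunE Hq Hp addr_gt0.
Qed.

End Swap.

Theorem proposition10 (R : realType) (m n : nat)
    (hm : (1 <= m)%N) (hmn : (3 <= m + n)%N)
    (Pi : set (cartan_dual R (m + n)))
    (hPi : Pi `<=` simple_roots R (m + n)) :
  let ap := alpha R (m + n) (m + n - 1) + alpha R (m + n) (m + n) in
  let am := alpha R (m + n) (m + n - 1) - alpha R (m + n) (m + n) in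
  compatible (so_odd_odd R m n) (std_parabolic Pi) <->
  ([set ap; am] `<=` Pi \/ [set ap; am] `&` Pi = set0).
Proof.
move=> ap am; have N1 : (1 < m + n)%N by exact: ltnW.
have -> : ([set ap; am] `<=` Pi \/ [set ap; am] `&` Pi = set0)
    <-> (Pi ap <-> Pi am).
  split=> [[sub|disj]|apm].
  - by split=> _; apply: sub; [right|left].
  - by split=> Pif; exfalso; [have : set0 ap|have : set0 am];
      rewrite // -disj; split=> //; [left|right].
  case: (pselect (Pi ap)) => [Pip|nPip]; [left|right].
    by move=> f [->|->] //; apply/apm.
  by rewrite -subset0 => f [[->|->] // /apm].
split=> [[H [gH _ pH]]|].
  apply: (mem_fork_swap (b := odd_sign m n)) => // X.
  by rewrite pH; apply: parabolic_of_conj; exact: odd_refl_comm.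
move=> /(dominant_exists N1) [H [Hdom HN]].
exists (vsval H); split.
- exact: cartan_so_odd_odd.
- exact: hyperbolic_dominant Hdom.
exact: parabolic_of_dominant.
Qed.
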